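(* Let $F$ be a regular or singular nonlinearity, let $N\ge1$ be the dimension and $B$ the unit ball. For any $\alpha>-2$, the change of variable $u(r)=w(r^{1+\frac\alpha2})$ gives a correspondence between the radially symmetric solutions of $$-\Delta_N u=\lambda\Big(1+\frac\alpha2\Big)^2|x|^\alpha F(u)\ \text{ in }B,\qquad u=0\ \text{ on }\partial B,$$ in dimension $N$, and those of $$-\Delta_{N(\alpha)}w=\lambda F(w)\ \text{ in }B,\qquad w=0\ \text{ on }\partial B,$$ in the (potentially fractional) dimension $N(\alpha)=\frac{2(N+\alpha)}{2+\alpha}$. Moreover, $$\lambda^*_\alpha(N)=\Big(1+\frac\alpha2\Big)^2\lambda^*_0(N(\alpha))\qquad\text{and}\qquad u^*_\alpha(r)=w^*(r^{1+\frac\alpha2}),$$ where $u^*_\alpha$ is the extremal solution of the first family of problems and $w^*$ is the extremal solution of the second family.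
   Context: A nonlinearity $F$ is a smooth, increasing, convex function on its domain $D_F=[0,a_F)$ with $F(0)=1$; it is regular if $a_F=+\infty$ and $F$ is superlinear, and singular if $a_F=1$ and $\lim_{u\nearrow1}F(u)=+\infty$. For a real number $d$ (a possibly fractional dimension) and a radial function $u=u(r)$, $r=|x|$, put $\Delta_d u:=u''+\frac{d-1}{r}u'$ on $(0,1)$; ''in $B$'' and ''on $\partial B$'' then mean $0\le r<1$ and $r=1$. For the problem $-\Delta_d u=\lambda|x|^\alpha F(u)$ in $B$, $u=0$ on $\partial B$, a solution is classical if $\|u\|_{L^\infty}<\infty$ ($F$ regular), resp. $\|u\|_{L^\infty}<1$ ($F$ singular); the extremal parameter (pull-in voltage) $\lambda^*_\alpha(d)$ is the supremum of the $\lambda>0$ for which a classical solution exists. The extremal solution is the pointwise limit of the minimal classical solutions $u_\lambda$ as $\lambda$ increases to the extremal parameter. Extremal solutions of the two families above are defined in the same way. On the ball with these radial profiles minimal and extremal solutions are radial. *)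

(* Defs.v *)
From mathcomp Require Import all_boot all_order all_algebra.
From mathcomp Require Import all_classical all_reals all_analysis.

Set Implicit Arguments.
Unset Strict Implicit.
Unset Printing Implicit Defensive.

Import Order.TTheory GRing.Theory Num.Theory.
Import numFieldNormedType.Exports.

Local Open Scope ring_scope.
Local Open Scope classical_set_scope.

(* The domain D_F = [0, a) of a nonlinearity is given by its right end point
   a = a_F in the extended reals; the values of F : R -> R outside D_F are
   irrelevant. *)
Definition nl_domain (R : realType) (a : \bar R) : set R :=
  [set x | 0 <= x /\ (x%:E < a)%E].

(* Smoothness on the half-open interval [0, a): F is smooth on (0, a), and F and
   all its derivatives have finite limits at 0+, the limit of F being F 0. *)
Definition smooth_on_domain (R : realType) (a : \bar R) (F : R -> R) : Prop :=
  F x @[x --> 0^'+] --> F 0 /\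
  forall n : nat,
    (forall x : R, 0 < x -> (x%:E < a)%E -> derivable F^`(n) x 1) /\
    cvg (F^`(n) x @[x --> 0^'+]).

Record nonlinearity (R : realType) (a : \bar R) (F : R -> R) : Prop :=
  Nonlinearity {
    nl_smooth : smooth_on_domain a F;
    nl_increasing : forall x y : R,
      nl_domain a x -> nl_domain a y -> x < y -> F x < F y;
    nl_convex : @convex_function R R^o (nl_domain a) F;
    nl_at0 : F 0 = 1 }.

Definition regular_nonlinearity (R : realType) (a : \bar R) (F : R -> R) : Prop :=
  [/\ nonlinearity a F, a = +oo%E & F x / x @[x --> +oo] --> +oo].

Definition singular_nonlinearity (R : realType) (a : \bar R) (F : R -> R) : Prop :=
  [/\ nonlinearity a F, a = 1%:E & F x @[x --> 1^'-] --> +oo].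

Definition radial_laplacian (R : realType) (d : R) (u : R -> R) (r : R) : R :=
  (u^`(2))%classic r + (d - 1) / r * (u^`())%classic r.

(* u is a radial solution of - Delta_d u = lambda f(|x|) F(u) in B, u = 0 on
   the boundary of B, with values in D_F.  Only the values on (0, 1] matter: a
   solution may be singular at the origin.  That the equation holds in all of B,
   origin included, is the vanishing of the flux r^(d-1) u'(r) at 0: it says that
   there is no point mass at the origin (for d = 1, that the even extension of u
   has no kink).  Smoothness at 0 cannot be asked for, since f(r) = r^alpha is
   singular there when alpha < 0. *)
Record radial_solution (R : realType) (a : \bar R) (F : R -> R)
    (d : R) (f : R -> R) (lambda : R) (u : R -> R) : Prop := RadialSolution {
  rs_range : forall r : R, 0 < r < 1 -> nl_domain a (u r);
  rs_derivable : forall r : R, 0 < r < 1 -> derivable u r 1 /\ derivable u^`() r 1;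
  rs_eq : forall r : R, 0 < r < 1 ->
    - radial_laplacian d u r = lambda * f r * F (u r);
  rs_flux : r `^ (d - 1) * (u^`())%classic r @[r --> 0^'+] --> (0 : R);
  rs_boundary : u 1 = 0 /\ u r @[r --> 1^'-] --> (0 : R) }.

(* The L^infinity bound covers both cases: it reads < +oo for F regular and < 1
   for F singular.  The value at 0 is the one given by continuity. *)
Record classical_solution (R : realType) (a : \bar R) (F : R -> R)
    (d : R) (f : R -> R) (lambda : R) (u : R -> R) : Prop := ClassicalSolution {
  cs_solution : radial_solution a F d f lambda u;
  cs_at0 : u r @[r --> 0^'+] --> u 0;
  cs_bounded : (ereal_sup [set `|u r|%:E | r in `[0%R, 1%R[] < a)%E }.

Definition minimal_solution (R : realType) (a : \bar R) (F : R -> R)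
    (d : R) (f : R -> R) (lambda : R) (u : R -> R) : Prop :=
  classical_solution a F d f lambda u /\
  forall v : R -> R, classical_solution a F d f lambda v ->
    forall r : R, 0 <= r <= 1 -> u r <= v r.

Definition extremal_parameter (R : realType) (a : \bar R) (F : R -> R)
    (d : R) (f : R -> R) : \bar R :=
  ereal_sup [set lambda%:E | lambda in
    [set l : R | 0 < l /\ exists u, classical_solution a F d f l u]].

(* lambda^*_alpha(d) *)
Definition pull_in_voltage (R : realType) (a : \bar R) (F : R -> R)
    (alpha d : R) : \bar R :=
  extremal_parameter a F d (fun r => r `^ alpha).

(* The extremal solution may be infinite at the origin. *)
Definition extremal_solution (R : realType) (a : \bar R) (F : R -> R)
    (d : R) (f : R -> R) (ustar : R -> \bar R) : Prop :=
  exists (lstar : R) (u_ : R -> R -> R),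
    [/\ extremal_parameter a F d f = lstar%:E,
        forall lambda : R, 0 < lambda < lstar ->
          minimal_solution a F d f lambda (u_ lambda)
      & forall r : R, 0 <= r <= 1 ->
          (u_ lambda r)%:E @[lambda --> lstar^'-] --> ustar r].

(* w |-> w \o phi is a bijection from S2 onto S1, functions being identified when
   they agree on [0, 1]. *)
Definition substitution_correspondence (R : realType) (phi : R -> R)
    (S1 S2 : set (R -> R)) : Prop :=
  (forall w : R -> R, S2 w -> S1 (fun r => w (phi r))) /\
  (forall u : R -> R, S1 u -> exists w : R -> R,
    [/\ S2 w, forall r : R, 0 <= r <= 1 -> u r = w (phi r)
      & forall w' : R -> R, S2 w' ->
          (forall r : R, 0 <= r <= 1 -> u r = w' (phi r)) ->
          forall s : R, 0 <= s <= 1 -> w' s = w s]).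

(* N(alpha) *)
Definition fractional_dimension (R : realType) (alpha N : R) : R :=
  2 * (N + alpha) / (2 + alpha).

(* Main.v *)
Require Import Defs.
From mathcomp Require Import all_boot all_order all_algebra.
From mathcomp Require Import all_classical all_reals all_analysis.
From mathcomp Require Import ring lra.

Set Implicit Arguments.
Unset Strict Implicit.
Unset Printing Implicit Defensive.

Import Order.TTheory GRing.Theory Num.Theory.
Import numFieldNormedType.Exports.

Local Open Scope ring_scope.
Local Open Scope classical_set_scope.

(** The substitution s = r^b turns the radial Laplacian in dimension d' into the
one in dimension d: if u(r) = w(r^b), then

  u'' + (d-1)/r u' = b^2 r^(2(b-1)) (w'' + (d'-1)/s w')   at s = r^b,

exactly when d - 2 = b (d' - 2), because the second derivative of r^b adds
b - 1 to the coefficient of the first-order term.  For b = 1 + alpha/2 the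
weight r^(2(b-1)) is r^alpha, and the relation between the dimensions is the
definition of N(alpha).  The flux r^(d-1) u' is b times the flux s^(d'-1) w',
and r^b is an increasing bijection of [0, 1] fixing both end points, so the
conditions at the origin and at the boundary, the range and the L^infinity
bound are carried along.

All the assumptions linking the two problems are gathered in [power_related].
This relation is symmetric up to replacing b by 1/b
([power_related_sym]), so it is enough to transport solutions in one direction
([classical_solution_comp_powR]): the other direction is the same lemma for the
exponent 1/b.  In particular the two problems have solutions for the same
parameters, hence the same extremal parameter.  As the substitution preserves
the pointwise order, it also matches the minimal solutions, hence their limits,
the extremal solutions, which are unique because minimal solutions are.  The
factor b^2 between the pull-in voltages comes only from moving the
constant b^2 of the weight into the parameter ([extremal_parameterZ]). *)

(** * The substitution r |-> r^b on the unit interval *)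

Lemma powRK (R : realType) (b r : R) : b != 0 -> 0 <= r ->
  (r `^ b) `^ b^-1 = r.
Proof. by move=> b0 r0; rewrite -powRrM divff// powRr1. Qed.

Lemma powR_itv01 (R : realType) (b r : R) : 0 < b -> 0 < r < 1 ->
  0 < r `^ b < 1.
Proof.
move=> b0 /andP[r0 r1]; rewrite powR_gt0//=.
have := @gt0_ltr_powR _ _ b0 r 1; rewrite powR1; apply => //.
  by rewrite nnegrE ltW.
by rewrite nnegrE.
Qed.

Lemma powR_itv01_cc (R : realType) (b r : R) : 0 <= b -> 0 <= r <= 1 ->
  0 <= r `^ b <= 1.
Proof.
move=> b0 /andP[r0 r1]; rewrite powR_ge0/=.
by have := @ge0_ler_powR _ _ b0 r 1; rewrite powR1; apply; rewrite ?nnegrE.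
Qed.

Lemma powR_cvg_right0 (R : realType) (b : R) : 0 < b ->
  r `^ b @[r --> 0^'+] --> 0^'+.
Proof.
move=> b0 P; rewrite /at_right /= !near_simpl near_withinE => nP.
have := powR_cvg0 b0 nP; rewrite !near_simpl => nP'.
near=> r; have r0 : 0 < r by near: r; exact: nbhs_right_gt.
have : 0 < r `^ b -> P (r `^ b) by near: r.
by apply; exact: powR_gt0.
Unshelve. all: by end_near. Qed.

Lemma powR_cvg_left1 (R : realType) (b : R) : 0 < b ->
  r `^ b @[r --> 1^'-] --> 1^'-.
Proof.
move=> b0 P; rewrite /at_left /= !near_simpl near_withinE => nP.
have cb : x `^ b @[x --> (1 : R)^'-] --> (1 : R).
  apply: cvg_at_left_filter.
  have : {for (1 : R), continuous (fun x : R => x `^ b)}.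
    apply: differentiable_continuous; apply/derivable1_diffP.
    by apply: derivable_powR; rewrite in_itv/= ltr01.
  by rewrite /prop_for /continuous_at powR1.
have := cb _ nP; rewrite !near_simpl => nP'.
near=> r.
have r0 : 0 < r by near: r; apply: nbhs_left_gt; exact: ltr01.
have r1 : r < 1 by near: r; exact: nbhs_left_lt.
have : r `^ b < 1 -> P (r `^ b) by near: r.
have r01 : 0 < r < 1 by rewrite r0.
by apply; have /andP[] := powR_itv01 b0 r01.
Unshelve. all: by end_near. Qed.

Lemma near_itv01 (R : realType) (r : R) : 0 < r < 1 ->
  \forall x \near r, 0 < x < 1.
Proof.
by move=> /near_in_itvoo; apply: filterS => x xi; rewrite !(itvP xi).
Qed.

Lemma is_derive_comp_powR (R : realType) (w : R -> R) (b r : R) : 0 < r ->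
  derivable w (r `^ b) 1 ->
  is_derive r 1 (fun x => w (x `^ b))
    (w^`()%classic (r `^ b) * (b * r `^ (b - 1))).
Proof.
move=> r0 dw.
apply: (@is_derive1_comp _ w (fun x => x `^ b)); last exact: is_derive1_powR.
by apply: DeriveDef => //; rewrite derive1E.
Qed.

Section SubstitutionDerivatives.
Variables (R : realType) (b : R) (w : R -> R).
Hypothesis b0 : 0 < b.
Hypothesis dw : forall s : R, 0 < s < 1 ->
  derivable w s 1 /\ derivable w^`()%classic s 1.

Lemma derive1_comp_powR (r : R) : 0 < r < 1 ->
  (fun x => w (x `^ b))^`()%classic r
  = w^`()%classic (r `^ b) * (b * r `^ (b - 1)).
Proof.
move=> r01; rewrite derive1E; apply: (@derive_val _ _ _ _ _ _ _ _).
by apply: is_derive_comp_powR; [case/andP: r01|case: (dw (powR_itv01 b0 r01))].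
Qed.

(** The two terms come from differentiating w'(x^b) and b x^(b-1); the second one
is responsible for the change of dimension. *)
Lemma is_derive2_comp_powR (r : R) : 0 < r < 1 ->
  is_derive r 1 (fun x => w (x `^ b))^`()%classic
    (w^`()^`()%classic (r `^ b) * (b * r `^ (b - 1)) ^+ 2
     + w^`()%classic (r `^ b) * (b * ((b - 1) * r `^ (b - 2)))).
Proof.
move=> r01; have r0 : 0 < r by case/andP: r01.
(* The formula for the first derivative is known on (0, 1) only, which is enough
   since a derivative at r depends on values near r. *)
apply: (@near_eq_is_derive _ _ _
  (fun x => w^`()%classic (x `^ b) * (b * x `^ (b - 1)))).
  have := near_itv01 r01; apply: filterS => x x01.
  by rewrite derive1_comp_powR.
have dA := is_derive_comp_powR r0 (dw (powR_itv01 b0 r01)).2.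
have dB : is_derive r 1 (fun x => b * x `^ (b - 1))
    (b * ((b - 1) * r `^ (b - 1 - 1))).
  have dP := @is_derive1_powR R (b - 1) r r0.
  by have := is_deriveZ b dP; rewrite /GRing.scale /=.
apply: (is_derive_eq (is_deriveM dA dB)).
rewrite (_ : b - 1 - 1 = b - 2); last by ring.
rewrite /GRing.scale /=; ring.
Qed.

End SubstitutionDerivatives.

(** * Transport of solutions *)

(** The condition on dimensions and weights under which w |-> w(r^b) maps
solutions in dimension d' with weight f' to solutions in dimension d with weight
f.  Writing d - 2 = b (d' - 2) rather than solving for d' makes it plain that
exchanging the problems inverts b.  The weights are compared on (0, 1) only,
since for b < 1 the factor r^(2(b-1)) is singular at the origin. *)
Definition power_related (R : realType) (b d d' : R) (f f' : R -> R) : Prop :=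
  [/\ 0 < b, d - 2 = b * (d' - 2)
    & forall r : R, 0 < r < 1 ->
        f r = b ^+ 2 * r `^ (2 * (b - 1)) * f' (r `^ b)].

(** At r = s^(1/b) the factor b^2 r^(2(b-1)) is inverse to
b^(-2) s^(2(1/b-1)), as it must be: they are the squared derivatives of two
functions inverse to each other. *)
Lemma power_related_sym (R : realType) (b d d' : R) (f f' : R -> R) :
  power_related b d d' f f' -> power_related b^-1 d' d f' f.
Proof.
move=> [b0 hd hf]; have bn0 : b != 0 by rewrite gt_eqF.
have ib0 : 0 < b^-1 by rewrite invr_gt0.
split=> // [|s s01]; first by rewrite hd mulKf.
have s0 : 0 < s by case/andP: s01.
have sn0 : s != 0 by rewrite gt_eqF.
rewrite (hf _ (powR_itv01 ib0 s01)).
have -> : (s `^ b^-1) `^ b = s.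
  by rewrite -{2}[b]invrK powRK ?invr_eq0 ?ltW.
rewrite -powRrM; set x := s `^ (2 * _); set y := s `^ (_ * _).
have xy : x * y = 1.
  rewrite /x /y -powRD ?sn0 ?implybT//.
  rewrite (_ : _ + _ = 0) ?powRr0//; by field.
transitivity (b^-1 ^+ 2 * b ^+ 2 * (x * y) * f' s); last by ring.
by rewrite xy mulr1 -exprMn mulVf// expr1n mul1r.
Qed.

Section Transport.
Variables (R : realType) (a : \bar R) (F : R -> R).
Implicit Types (b d l : R) (f : R -> R).

(** With p = r^(b-1) and s = p r, the chain rule gives
u'' + (d-1)/r u' = b^2 p^2 w'' + b p/r (b - 1 + d - 1) w', and
b + (d - 2) = b (d' - 1) makes b^2 p^2 a common factor.  The same identity
r^(d-1) r^(b-1) = s^(d'-1) handles the flux. *)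
Lemma radial_solution_comp_powR b d d' f f' l w :
  power_related b d d' f f' ->
  radial_solution a F d' f' l w ->
  radial_solution a F d f l (fun r => w (r `^ b)).
Proof.
move=> [b0 hd hf] [wrange wder weq wflux [w1 wlim]].
split=> [r r01|r r01|r r01||].
- exact: wrange (powR_itv01 b0 r01).
- have r0 : 0 < r by case/andP: r01.
  split; last by case: (is_derive2_comp_powR b0 wder r01).
  by case: (is_derive_comp_powR r0 (wder _ (powR_itv01 b0 r01)).1).
- have r0 : 0 < r by case/andP: r01.
  have rn0 : r != 0 by rewrite gt_eqF.
  have := weq _ (powR_itv01 b0 r01); rewrite (hf _ r01) /radial_laplacian.
  rewrite !derive1nS !derive1n0 (derive1_comp_powR b0 wder r01).
  rewrite [in X in _ -> X](derive1E _^`()%classic).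
  rewrite (@derive_val _ _ _ _ _ _ _ (is_derive2_comp_powR b0 wder r01)).
  set p := r `^ (b - 1).
  have p0 : p != 0 by rewrite gt_eqF// powR_gt0.
  have -> : r `^ (b - 2) = p / r.
    rewrite /p -[X in _ / X]powRr1 ?ltW// -powRB ?rn0 ?implybT//.
    by congr (_ `^ _); ring.
  have -> : r `^ (2 * (b - 1)) = p ^+ 2.
    by rewrite mulrC powRrM powR_mulrn// powR_ge0.
  have sE : r `^ b = p * r.
    by rewrite mulrC mulr_powRB1// ltW.
  have -> : d = b * (d' - 2) + 2 by rewrite -hd subrK.
  move: (F _) (f' _) => Fw fs; move: (w^`()^`()%classic _) (w^`()%classic _).
  rewrite sE => w2 w1' e.
  transitivity (b ^+ 2 * p ^+ 2 * - (w2 + (d' - 1) / (p * r) * w1')).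
    by field; rewrite rn0 p0.
  by rewrite e; ring.
- rewrite -[X in _ --> X](mulr0 b).
  have : b * ((r `^ b) `^ (d' - 1) * w^`()%classic (r `^ b)) @[r --> 0^'+]
      --> b * 0.
    apply: cvgM; first exact: cvg_cst.
    exact: (cvg_comp _ _ (powR_cvg_right0 b0) wflux).
  apply: cvg_trans; apply: near_eq_cvg; near=> r.
  have r0 : 0 < r by near: r; exact: nbhs_right_gt.
  have r1 : r < 1 by near: r; apply: nbhs_right_lt; exact: ltr01.
  have rn0 : r != 0 by rewrite gt_eqF.
  rewrite derive1_comp_powR ?r0// -powRrM.
  have -> : b * (d' - 1) = (d - 1) + (b - 1).
    by rewrite -[d](subrK 2) hd; ring.
  by rewrite powRD ?rn0 ?implybT//; ring.
- rewrite powR1; split=> //.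
  exact: (cvg_comp _ _ (powR_cvg_left1 b0) wlim).
Unshelve. all: by end_near. Qed.

Lemma classical_solution_comp_powR b d d' f f' l w :
  power_related b d d' f f' ->
  classical_solution a F d' f' l w ->
  classical_solution a F d f l (fun r => w (r `^ b)).
Proof.
move=> hpr; have [b0 _ _] := hpr; move=> [wsol w0 wbd]; split.
- exact: radial_solution_comp_powR hpr wsol.
- rewrite powR0 ?gt_eqF//.
  exact: (cvg_comp _ _ (powR_cvg_right0 b0) w0).
- apply: le_lt_trans wbd; apply: ereal_sup_le => _ [r /= + <-].
  rewrite in_itv/= => /andP[r0 r1]; exists (r `^ b) => //=.
  rewrite in_itv/= powR_ge0/=; move: r0; rewrite le_eqVlt => /predU1P[<-|r0].
    by rewrite powR0 ?gt_eqF.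
  have r01 : 0 < r < 1 by rewrite r0.
  by have /andP[] := powR_itv01 b0 r01.
Qed.

(** A competitor v for the transported problem is pulled back by the exponent 1/b
and compared with w at the point r^b. *)
Lemma minimal_solution_comp_powR b d d' f f' l w :
  power_related b d d' f f' ->
  minimal_solution a F d' f' l w ->
  minimal_solution a F d f l (fun r => w (r `^ b)).
Proof.
move=> hpr [wsol wmin]; have [b0 _ _] := hpr.
split=> [|v vsol r r01]; first exact: classical_solution_comp_powR hpr wsol.
have := wmin _ (classical_solution_comp_powR (power_related_sym hpr) vsol).
move=> /(_ (r `^ b)); rewrite powRK ?gt_eqF//; last by case/andP: r01.
by apply; rewrite powR_itv01_cc// ltW.
Qed.

Lemma substitution_correspondence_powR b (S1 S2 : set (R -> R)) : 0 < b ->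
  (forall w, S2 w -> S1 (fun r => w (r `^ b))) ->
  (forall u, S1 u -> S2 (fun s => u (s `^ b^-1))) ->
  substitution_correspondence (fun r => r `^ b) S1 S2.
Proof.
move=> b0 S21 S12; split=> // u /S12 Su; exists (fun s => u (s `^ b^-1)).
split=> // [r /andP[r0 _]|w' _ w'E s s01]; first by rewrite powRK ?gt_eqF.
have ib0 : 0 <= b^-1 by rewrite invr_ge0 ltW.
rewrite w'E; last exact: powR_itv01_cc.
by rewrite -{2}[b]invrK powRK ?invr_eq0 ?gt_eqF//; case/andP: s01.
Qed.

Lemma extremal_parameter_power_related b d d' f f' :
  power_related b d d' f f' ->
  extremal_parameter a F d f = extremal_parameter a F d' f'.
Proof.
move=> hpr; congr (ereal_sup (EFin @` _)); apply/seteqP.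
split=> l [l0 [u usol]]; split=> //.
  by exists (fun s => u (s `^ b^-1));
     exact: classical_solution_comp_powR (power_related_sym hpr) usol.
by exists (fun r => u (r `^ b)); exact: classical_solution_comp_powR hpr usol.
Qed.

Lemma extremal_solution_comp_powR b d d' f f' wstar :
  power_related b d d' f f' ->
  extremal_solution a F d' f' wstar ->
  extremal_solution a F d f (fun r => wstar (r `^ b)).
Proof.
move=> hpr [l [w_ [lE wmin wlim]]]; have [b0 _ _] := hpr.
exists l, (fun m r => w_ m (r `^ b)); split=> [|m m0l|r r01].
- by rewrite (extremal_parameter_power_related hpr).
- exact: minimal_solution_comp_powR hpr (wmin _ m0l).
- by apply: wlim; rewrite powR_itv01_cc// ltW.
Qed.

(** The supremum of the empty set is -oo, so a finite extremal parameter bounds an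
existing positive parameter. This makes the left neighbourhoods of
l consist of parameters in (0, l). *)
Lemma extremal_parameter_gt0 d f l :
  extremal_parameter a F d f = l%:E -> 0 < l.
Proof.
move=> lE.
have [[m [m0 msol]]|none] := pselect
    (exists m, 0 < m /\ exists u, classical_solution a F d f m u).
  apply: (lt_le_trans m0); rewrite -lee_fin -lE.
  by apply: ereal_sup_ubound; exists m.
suff : extremal_parameter a F d f = -oo%E by rewrite lE.
by apply/ereal_sup_ninfty => x [m hm _]; case: none; exists m.
Qed.

(** Two minimal solutions for one parameter bound each other, so the two families
coincide on [0, 1] below the extremal parameter and have the same limit. *)
Lemma extremal_solution_unique d f u v (r : R) :
  extremal_solution a F d f u -> extremal_solution a F d f v ->
  0 <= r <= 1 -> u r = v r.
Proof.
move=> [l [u_ [lE umin ulim]]] [m [v_ [mE vmin vlim]]] r01.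
have ml : m = l by apply: EFin_inj; rewrite -lE -mE.
subst m; have l0 := extremal_parameter_gt0 lE.
apply: (cvg_unique (@ereal_hausdorff R) (ulim _ r01)).
apply: cvg_trans (vlim _ r01); apply: near_eq_cvg; near=> k.
have k0l : 0 < k < l.
  apply/andP; split; near: k; [exact: nbhs_left_gt | exact: nbhs_left_lt].
have [[us umin'] [vs vmin']] := (umin _ k0l, vmin _ k0l).
by congr (_%:E); apply/le_anti; rewrite umin' ?vmin'.
Unshelve. all: by end_near. Qed.

(** Solving with the weight c f and the parameter l is solving with the weight f
and the parameter c l. *)
Lemma extremal_parameterZ d f c : 0 < c ->
  extremal_parameter a F d f
  = (c%:E * extremal_parameter a F d (fun r => c * f r)%R)%E.
Proof.
move=> c0; have cn0 : c != 0 by rewrite gt_eqF.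
have scale k g l u : k != 0 -> classical_solution a F d g (k * l) u ->
    classical_solution a F d (fun r => k * g r) l u.
  move=> k0 [[h1 h2 h3 h4 h5] h6 h7]; split=> //; split=> // r r01.
  by rewrite h3//; ring.
rewrite /extremal_parameter -ereal_sup_pZl//; congr ereal_sup.
apply/seteqP; split=> [_ [l [l0 [u us]] <-]|_ [_ [l [l0 [u us]] <-] <-]].
- exists (c^-1 * l)%:E; last by rewrite -EFinM mulVKf.
  exists (c^-1 * l) => //; split; first by rewrite mulr_gt0 ?invr_gt0.
  by exists u; apply: scale => //; rewrite mulVKf.
- exists (c * l) => //; split; first by rewrite mulr_gt0.
  exists u; have := scale c^-1 (fun r => c * f r) (c * l) u.
  rewrite mulKf// invr_eq0 => /(_ cn0 us).
  by congr classical_solution; apply/funext => r; rewrite mulKf.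
Qed.

End Transport.

(** * The change of dimension *)

Theorem proposition4p2 (R : realType) (a : \bar R) (F : R -> R)
    (hF : regular_nonlinearity a F \/ singular_nonlinearity a F)
    (N : nat) (hN : (1 <= N)%N) (alpha : R) (halpha : -2 < alpha) :
  let beta := 1 + alpha / 2 in
  let Na := fractional_dimension alpha N%:R in
  let f1 := fun r : R => beta ^+ 2 * r `^ alpha in
  let f2 := fun _ : R => 1 : R in
  [/\ forall lambda : R,
        substitution_correspondence (fun r => r `^ beta)
          (radial_solution a F N%:R f1 lambda)
          (radial_solution a F Na f2 lambda),
      forall lambda : R,
        substitution_correspondence (fun r => r `^ beta)
          (classical_solution a F N%:R f1 lambda)
          (classical_solution a F Na f2 lambda),
      pull_in_voltage a F alpha N%:R =
        ((beta ^+ 2)%:E * pull_in_voltage a F 0 Na)%E,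
      (exists ustar : R -> \bar R, extremal_solution a F N%:R f1 ustar) <->
        (exists wstar : R -> \bar R, extremal_solution a F Na f2 wstar)
    & forall ustar wstar : R -> \bar R,
        extremal_solution a F N%:R f1 ustar ->
        extremal_solution a F Na f2 wstar ->
        forall r : R, 0 <= r <= 1 -> ustar r = wstar (r `^ beta)].
Proof.
move=> beta Na f1 f2.
have b0 : 0 < beta by rewrite /beta; lra.
have hpr : power_related beta N%:R Na f1 f2.
  split=> // [|r _].
    rewrite /Na /fractional_dimension /beta; field.
    by rewrite gt_eqF//; lra.
  rewrite /f1 /f2 mulr1 (_ : 2 * (beta - 1) = alpha)// /beta; by field.
have hrp := power_related_sym hpr.
split.
- move=> l; apply: substitution_correspondence_powR => // v.
    exact: radial_solution_comp_powR hpr.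
  exact: radial_solution_comp_powR hrp.
- move=> l; apply: substitution_correspondence_powR => // v.
    exact: classical_solution_comp_powR hpr.
  exact: classical_solution_comp_powR hrp.
- rewrite /pull_in_voltage (_ : (fun r : R => r `^ 0) = f2); last first.
    by apply/funext => r; rewrite powRr0.
  rewrite -(extremal_parameter_power_related a F hpr).
  exact: extremal_parameterZ (exprn_gt0 2 b0).
- split=> -[v vext].
    exists (fun s => v (s `^ beta^-1)).
    exact: extremal_solution_comp_powR hrp vext.
  exists (fun r => v (r `^ beta)).
  exact: extremal_solution_comp_powR hpr vext.
- move=> u w uext wext r.
  exact: extremal_solution_unique uext (extremal_solution_comp_powR hpr wext).
Qed.
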